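(* Let $\Gamma$ be a set and $\lambda:\Gamma\to\Gamma$ a function. The following conditions are equivalent: (a) $\lambda$ is bounded; (b) $s(\lambda)=o(\lambda)=l(\lambda)=p(\lambda)=0$; (c) there exists $N\in\mathbb N_+$ such that $\lambda^{-N}(\Gamma\setminus\mathrm{Per}(\lambda))=\emptyset$ and $\mathrm{Per}(\lambda)=\mathrm{Per}_N(\lambda)$; (d) there exists $N\in\mathbb N_+$ such that $\lambda^{N}(\Gamma)=\mathrm{Per}(\lambda)$ and $\mathrm{Per}(\lambda)=\mathrm{Per}_N(\lambda)$; (e) $\lambda$ is quasi-periodic.
   Context: $\mathbb N$ contains $0$ and $\mathbb N_+$ is the set of positive integers. For $A\subseteq\Gamma$, $\lambda^{-N}(A)=(\lambda^N)^{-1}(A)$. Preorder: $i\leq_\lambda j$ iff $\lambda^s(j)=i$ for some $s\in\mathbb N$. A subset $I\subseteq\Gamma$ is totally preordered if for all $i,j\in I$ either $i\leq_\lambda j$ or $j\leq_\lambda i$ (antisymmetry not required). $\lambda$ is bounded if there exists $N\in\mathbb N$ such that $|I|\leq N$ for every totally preordered subset $I$ of $(\Gamma,\leq_\lambda)$. $\lambda$ is quasi-periodic if $\lambda^n=\lambda^m$ for some $n<m$ in $\mathbb N$. A point $x$ is periodic for $\lambda$ if $\lambda^n(x)=x$ for some $n\in\mathbb N_+$; its period is the least such $n$. $\mathrm{Per}(\lambda)$ is the set of all periodic points and $\mathrm{Per}_n(\lambda)$ the set of periodic points of period at most $n$. A string of $\lambda$ is a sequence $\{s_t\}_{t\in\mathbb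 N}$ of pairwise distinct elements of $\Gamma$ with $\lambda(s_t)=s_{t-1}$ for every $t\in\mathbb N_+$. An infinite orbit of $\lambda$ is a sequence $\{a_t\}_{t\in\mathbb N}$ of pairwise distinct elements of $\Gamma$ with $\lambda(a_t)=a_{t+1}$ for every $t\in\mathbb N$. A ladder of $\lambda$ is a subset $L=\bigcup_{m\in\mathbb N}L_m$ of $\Gamma$ which is a disjoint union of non-empty finite subsets $L_m=\{l_{m,0},l_{m,1},\ldots,l_{m,b_m}\}$ of $\Gamma\setminus\mathrm{Per}(\lambda)$ such that $\lambda(l_{m,k})=l_{m,k-1}$ for every $k\in\{1,\ldots,b_m\}$, $\lambda^{-1}(l_{m,b_m})=\emptyset$, and $b_s<b_t$ whenever $s<t$ in $\mathbb N$. A periodic ladder of $\lambda$ is a subset $P$ of $\Gamma$ with a partition $P=\bigcup_{n\in\mathbb N_+}P_n$, where for every $n\in\mathbb N_+$ the set $P_n$ is finite, $|P_n|\geq n$, and $\lambda\restriction_{P_n}:P_n\to P_n$ is a cycle of length $|P_n|$. $s(\lambda)$, $o(\lambda)$, $l(\lambda)$, $p(\lambda)$ denote the supremum of the cardinalities $|\mathcal F|$ of families $\mathcal F$ of pairwise disjoint strings, infinite orbits, ladders, and periodic ladders of $\lambda$ in $\Gamma$, respectively (so each is $0$ iff no such object exists). *)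

(* Defs.v *)
From mathcomp Require Import all_boot.
From mathcomp Require Import mathcomp_extra boolp classical_sets functions
  cardinality.

Set Implicit Arguments.
Unset Strict Implicit.
Unset Printing Implicit Defensive.

Local Open Scope classical_set_scope.
Local Open Scope card_scope.

(* Cardinal numbers (at most that of U) are represented by equipotence classes
   of subsets of U. *)
Definition cardinal U (A : set U) : set (set U) := [set B | B #= A].

Definition cardinal0 {U} : set (set U) := cardinal (@set0 U).

(* The supremum of the cardinals #|F|, F in Fs: the class of all K whose
   cardinal is a least upper bound.  Bounds K' need only range over subsets of
   U, since #|U| is itself an upper bound. *)
Definition sup_cardinal U (Fs : set (set U)) : set (set U) :=
  [set K | (forall F, Fs F -> F #<= K) /\
           (forall K' : set U, (forall F, Fs F -> F #<= K') -> K #<= K')].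

Section SelfMaps.
Variables (T : Type) (f : T -> T).
Implicit Types (x i j : T) (A I L P : set T) (s a : nat -> T) (n m N k : nat).

Definition preorder_le i j : Prop := exists n, iter n f j = i.

Definition totally_preordered I : Prop :=
  forall i j, I i -> I j -> preorder_le i j \/ preorder_le j i.

Definition bounded_map : Prop :=
  exists N, forall I, totally_preordered I -> I #<= `I_N.

Definition quasi_periodic : Prop :=
  exists n m, n < m /\ iter n f = iter m f.

Definition periodic_point x : Prop := exists2 n, 0 < n & iter n f x = x.

Definition is_period x n : Prop :=
  [/\ 0 < n, iter n f x = x & forall m, 0 < m -> iter m f x = x -> n <= m].

Definition Per : set T := [set x | periodic_point x].

Definition Per_le N : set T := [set x | exists2 n, is_period x n & n <= N].

Definition is_string s : Prop :=
  injective s /\ forall n, f (s n.+1) = s n.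

Definition is_infinite_orbit a : Prop :=
  injective a /\ forall n, f (a n) = a n.+1.

(* l m enumerates L_m on the indices 0, ..., b m; the values of l m beyond b m
   are irrelevant. *)
Definition is_ladder L : Prop :=
  exists (b : nat -> nat) (l : nat -> nat -> T),
    let Lm m := [set l m k | k in [set k | k <= b m]] in
    [/\ L = \bigcup_m Lm m /\ trivIset setT Lm,
        forall m, Lm m `<=` ~` Per,
        forall m k, 0 < k <= b m -> f (l m k) = l m k.-1,
        forall m, f @^-1` [set l m (b m)] = set0 &
        forall m n, m < n -> b m < b n].

Definition is_cycle_on A k : Prop :=
  exists2 c : nat -> T, set_bij `I_k A c &
    forall n, n < k -> f (c n) = c (n.+1 %% k).

(* In P n, only the indices n > 0 matter. *)
Definition is_periodic_ladder L : Prop :=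
  exists P : nat -> set T,
    [/\ L = \bigcup_(n in [set n | 0 < n]) P n,
        trivIset [set n | 0 < n] P &
        forall n, 0 < n ->
          exists k, [/\ P n #= `I_k, n <= k & is_cycle_on (P n) k]].

(* trivIset F D says that distinct members of the family F have disjoint
   images under D. *)
Definition string_number : set (set (nat -> T)) :=
  sup_cardinal [set F | F `<=` [set s | is_string s] /\
                        trivIset F (fun s => range s)].

Definition orbit_number : set (set (nat -> T)) :=
  sup_cardinal [set F | F `<=` [set a | is_infinite_orbit a] /\
                        trivIset F (fun a => range a)].

Definition ladder_number : set (set (set T)) :=
  sup_cardinal [set F | F `<=` [set L | is_ladder L] /\ trivIset F id].

Definition periodic_ladder_number : set (set (set T)) :=
  sup_cardinal [set F | F `<=` [set L | is_periodic_ladder L] /\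
                        trivIset F id].

End SelfMaps.

(* Main.v *)
(* The work is in (b) => (c).  Without infinite orbits every point eventually
   enters Per, and without strings the backward trees of non-periodic points
   are well-founded.  If iter N lambda never maps all of Gamma into Per, then
   either some non-periodic x has backward paths of unbounded length, and a
   minimal such x has children of finite unbounded heights, or the non-periodic
   points sent into Per by lambda have finite unbounded heights.  In both cases
   these points have disjoint backward trees, whose longest branches form a
   ladder.  If the periods are unbounded, cycles of increasing lengths form a
   periodic ladder.
   For (e) => (a), a totally preordered set has a top element j, hence lies in
   the forward orbit of j, which is finite. *)
Require Import Defs.
From mathcomp Require Import all_boot.
From mathcomp Require Import mathcomp_extra boolp classical_sets functions
  cardinality.
Local Open Scope classical_set_scope.
Local Open Scope card_scope.

(** * Vanishing suprema of cardinals, and selection principles *)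

(** Singleton families are trivially disjoint, so one object already forces a nonzero supremum. This
    turns (b) into four non-existence statements. *)
Lemma sup_cardinal_eq0 U V (D : U -> set V) (P : set U) :
  sup_cardinal [set F | F `<=` P /\ trivIset F D] = cardinal0 <->
  forall x, ~ P x.
Proof.
split=> [E x Px|noP].
- have [/(_ [set x]) + _] : sup_cardinal [set F | F `<=` P /\ trivIset F D] set0.
    by rewrite E; exact: card_eqxx.
  have Fx : [set x] `<=` P /\ trivIset [set x] D.
    by split=> [y ->|y z -> ->].
  by move=> /(_ Fx); rewrite card_le0 => /eqP /seteqP[/(_ x erefl)].
- apply/seteqP; split=> K /=; rewrite /cardinal0 /cardinal /=.
  + move=> [_ /(_ set0)]; rewrite card_eq0 card_le0; apply.
    by move=> F [FP _]; rewrite card_le0; apply/eqP/seteqP; split=> // x /FP /noP.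
  + rewrite card_eq0 => /eqP ->; split=> [F [FP _]|K' _]; last exact: card_ge0.
    by rewrite card_le0; apply/eqP/seteqP; split=> // x /FP /noP.
Qed.

(** Each new pair is chosen with value above the previous one. This supplies both cycles of
    increasing length and ladder rungs of increasing height. *)
Lemma increasing_choice T (R : T -> nat -> Prop) :
  (forall N, exists x n, N <= n /\ R x n) ->
  exists (u : nat -> T) (p : nat -> nat),
    (forall k, R (u k) (p k)) /\ {homo p : i j / i < j}.
Proof.
move=> H.
have /choice[g gP] : forall N, exists xn : T * nat, N <= xn.2 /\ R xn.1 xn.2.
  by move=> N; have [x [n ?]] := H N; exists (x, n).
pose v k := iter k (fun xn => g xn.2.+1) (g 0).
exists (fun k => (v k).1), (fun k => (v k).2); split.
  by case=> [|k]; [have [] := gP 0|have [] := gP (v k).2.+1].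
apply: homo_ltn; first exact: ltn_trans.
by move=> k /=; have [] := gP (v k).2.+1.
Qed.

Lemma nat_ex_max (P : nat -> Prop) N :
  (exists n, P n) -> (forall n, P n -> n <= N) ->
  exists n, P n /\ forall m, P m -> m <= n.
Proof.
move=> exP ub.
have exQ : exists n, `[< P n >] by have [n Pn] := exP; exists n; exact/asboolP.
have ubQ n : `[< P n >] -> n <= N by move/asboolP/ub.
case: (ex_maxnP exQ ubQ) => n /asboolP Pn maxn; exists n; split=> // m Pm.
exact/maxn/asboolP.
Qed.

Lemma nat_ex_min (P : nat -> Prop) :
  (exists n, P n) -> exists n, P n /\ forall m, P m -> n <= m.
Proof.
move=> [n0 P0].
have exQ : exists n, `[< P n >] by exists n0; exact/asboolP.
case: (ex_minnP exQ) => n /asboolP Pn minn; exists n; split=> // m Pm.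
exact/minn/asboolP.
Qed.

Section SelfMapTheory.
Local Set Implicit Arguments.
Local Unset Strict Implicit.
Variables (T : Type) (f : T -> T).
Implicit Types (x y : T) (A I L : set T) (s : nat -> T) (n m N k : nat).

(** * Iterates, periodic points and periods *)

Lemma iter_Per x n : Per f x -> Per f (iter n f x).
Proof.
by move=> [k k0 kx]; exists k => //; rewrite -iterD addnC iterD kx.
Qed.

Lemma iter_mul_fixed x n k : iter n f x = x -> iter (k * n) f x = x.
Proof. by move=> nx; elim: k => //= k IH; rewrite mulSn iterD IH. Qed.

Lemma iter_eq_Per x n m : n < m -> iter n f x = iter m f x -> Per f (iter n f x).
Proof.
move=> nm E; exists (m - n); first by rewrite subn_gt0.
by rewrite -iterD subnK 1?ltnW.
Qed.

Lemma Per_has_period x : Per f x -> exists n, is_period f x n.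
Proof.
move=> [n n0 nx].
have [|p [[p0 px] pmin]] := @nat_ex_min (fun n => 0 < n /\ iter n f x = x).
  by exists n.
by exists p; split=> // m m0 mx; apply: pmin.
Qed.

Lemma is_period_uniq x n m : is_period f x n -> is_period f x m -> n = m.
Proof.
move=> [n0 nx nmin] [m0 mx mmin].
by apply/eqP; rewrite eqn_leq nmin // mmin.
Qed.

Lemma is_period_iter x n k : is_period f x n -> is_period f (iter k f x) n.
Proof.
move=> [n0 nx nmin]; split=> //; first by rewrite -iterD addnC iterD nx.
move=> m m0 mk; apply: nmin => //.
(* Completing [k] steps to [k * n] steps returns to [x], so whatever fixes [iter k f x] also fixes
   [x]. *)
have back : iter (k * n - k) f (iter k f x) = x.
  by rewrite -iterD subnK ?iter_mul_fixed // leq_pmulr.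
by rewrite -[in LHS]back -iterD addnC iterD mk.
Qed.

Lemma is_period_inj x n : is_period f x n ->
  set_inj `I_n (fun k => iter k f x).
Proof.
move=> px i j; rewrite !inE /= => ilt jlt E.
wlog ij : i j ilt jlt E / i < j.
  by move=> W; case: (ltngtP i j) => // ij; [apply: W|apply/esym/W].
have [_ _ /(_ (j - i))] := is_period_iter i px.
rewrite subn_gt0 -iterD (subnK (ltnW ij)) => /(_ ij (esym E)).
by rewrite leqNgt (leq_ltn_trans (leq_subr _ _)).
Qed.

Lemma Per_leS n m : n <= m -> Per_le f n `<=` Per_le f m.
Proof. by move=> nm x [p px pn]; exists p => //; exact: leq_trans nm. Qed.

Lemma Per_le_sub n : Per_le f n `<=` Per f.
Proof. by move=> x [p [p0 px _] _]; exists p. Qed.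

(** * Bounded maps admit no strings, infinite orbits or ladders of either kind *)

(** The [N.+1] distinct values form a chain that is too large. The ascending alternative serves
    strings and ladders, the descending one orbits and cycles. *)
Lemma bounded_injF N (g : nat -> T) :
  (forall I, totally_preordered f I -> I #<= `I_N) ->
  set_inj `I_N.+1 g ->
  (forall i j, i <= j -> j <= N -> preorder_le f (g i) (g j)) \/
  (forall i j, i <= j -> j <= N -> preorder_le f (g j) (g i)) -> False.
Proof.
move=> bd ginj gle.
have /bd : totally_preordered f (g @` `I_N.+1).
  move=> _ _ [i /= iN <-] [j /= jN <-].
  case: gle => gle; case: (leqP i j) => ij; [left|right|right|left];
    by apply: gle => //; exact: ltnW.
by rewrite (card_le_eql (inj_card_eq ginj)) card_le_II ltnn.
Qed.

Lemma string_iter s n k :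
  (forall i, f (s i.+1) = s i) -> iter n f (s (n + k)) = s k.
Proof. by move=> fs; elim: n => // n IH; rewrite addSn iterSr fs. Qed.

Lemma bounded_no_string : bounded_map f -> forall s, ~ is_string f s.
Proof.
move=> [N bd] s ss; apply: (@bounded_injF N s bd).
  by move=> i j _ _; apply: ss.1.
by left=> i j ij _; exists (j - i); rewrite -[in s j](subnK ij) string_iter //; case: ss.
Qed.

Lemma orbit_iter s n k : is_infinite_orbit f s -> iter n f (s k) = s (n + k).
Proof. by move=> [_ fs]; elim: n => //= n ->; rewrite fs. Qed.

Lemma bounded_no_orbit : bounded_map f -> forall s, ~ is_infinite_orbit f s.
Proof.
move=> [N bd] s ss; apply: (@bounded_injF N s bd).
  by move=> i j _ _; apply: ss.1.
by right=> i j ij _; exists (j - i); rewrite orbit_iter // subnK.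
Qed.

Lemma bounded_no_ladder : bounded_map f -> forall L, ~ is_ladder f L.
Proof.
move=> [N bd] L [b [l [_ np fl _ bmono]]].
(* Rung [N] thus has enough points for a chain of [N.+1]. *)
have bN m : m <= b m.
  by elim: m => // m IH; apply: leq_ltn_trans IH (bmono _ _ _).
have li n i : n + i <= b N -> iter n f (l N (n + i)) = l N i.
  elim: n => //= n IH nib; rewrite -iterS iterSr fl ?addSn //=.
  by apply: IH; apply: ltnW.
have {}li i j : i <= j -> j <= N -> iter (j - i) f (l N j) = l N i.
  by move=> ij jN; rewrite -[in l N j](subnK ij) li ?subnK // (leq_trans jN).
apply: (@bounded_injF N (l N) bd); last first.
  by left=> i j ij jN; exists (j - i); apply: li.
move=> i j; rewrite !inE /= !ltnS => iN jN E.
wlog ij : i j iN jN E / i < j.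
  by move=> W; case: (ltngtP i j) => // ij; [apply: W|apply/esym/W].
(* A repetition inside a rung would make its point periodic. *)
exfalso; apply: (np N (l N j)); first by exists j => //=; apply: leq_trans (bN N).
by exists (j - i); rewrite ?subn_gt0 // li // ltnW.
Qed.

Lemma bounded_no_periodic_ladder :
  bounded_map f -> forall L, ~ is_periodic_ladder f L.
Proof.
move=> [N bd] L [P [_ _ /(_ N.+1 isT)[k [_ Nk [c [_ cinj _] fc]]]]].
(* Before the wrap-around, the cycle acts as a plain shift. *)
have ci n i : n + i < k -> iter n f (c i) = c (n + i).
  by elim: n => //= n IH nik; rewrite IH 1?ltnW // fc 1?ltnW // modn_small.
apply: (@bounded_injF N c bd).
  by move=> i j; rewrite !inE /= => iN jN; apply: cinj; rewrite inE /=;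
    apply: leq_trans Nk.
right=> i j ij jN; exists (j - i).
by rewrite ci subnK // (leq_ltn_trans jN).
Qed.

(** * Ladders obtained from unbounded periods or heights *)

(** Points of one cycle share their period, so cycles of strictly increasing periods are disjoint,
    and the [n]-th has length at least [n]. *)
Lemma unbounded_period_ladder :
  (forall N, exists x n, N <= n /\ is_period f x n) ->
  exists L, is_periodic_ladder f L.
Proof.
move=> /increasing_choice[u [p [up pmono]]].
have ple n : n <= p n by elim: n => // n IH; apply: leq_ltn_trans IH (pmono _ _ _).
pose P n := [set iter k f (u n) | k in `I_(p n)].
exists (\bigcup_(n in [set n | 0 < n]) P n), P; split=> //.
- move=> n m _ _ [x [[i _ <-] [j _ E]]].
  have pE : p n = p m.
    apply: is_period_uniq (is_period_iter i (up n)) _.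
    by rewrite -E; apply: is_period_iter.
  by case: (ltngtP n m) => // /pmono; rewrite pE ltnn.
- move=> n n0; exists (p n); split=> //.
    exact: inj_card_eq (is_period_inj (up n)).
  exists (fun k => iter k f (u n)).
    split=> [k kp||y //]; first by exists k.
    exact: (is_period_inj (up n)).
  move=> k kp /=; move: (kp); rewrite leq_eqVlt => /orP[/eqP E|lt].
    by rewrite -iterS E modnn; case: (up n).
  by rewrite modn_small.
Qed.

(** Periodic points satisfy this by running around their cycle; it is informative only off
    [Per f]. *)
Definition unbounded_height x := forall N, exists k y, N <= k /\ iter k f y = x.

Definition height x n :=
  (exists y, iter n f y = x) /\ forall k y, iter k f y = x -> k <= n.

Lemma height_uniq x n m : height x n -> height x m -> n = m.
Proof.
move=> [[y yn] nmax] [[z zm] mmax]; apply/eqP.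
by rewrite eqn_leq (mmax _ _ yn) (nmax _ _ zm).
Qed.

Lemma has_height x : ~ unbounded_height x -> exists n, height x n.
Proof.
move=> /existsNP[N nN].
have [||n [? nmax]] := @nat_ex_max (fun k => exists y, iter k f y = x) N.
- by exists 0, x.
- move=> k [y yk]; rewrite leqNgt; apply/negP => Nk; apply: nN.
  by exists k, y; split=> //; exact: ltnW.
- by exists n; split=> // k y yk; apply: nmax; exists y.
Qed.

(** A common point of two backward trees would have both roots in its forward orbit, making them
    comparable; so trees rooted in the antichain [A] are disjoint. *)
Lemma antichain_ladder A : A `<=` ~` Per f ->
  (forall x y n, A x -> A y -> iter n f x = y -> x = y) ->
  (forall x, A x -> ~ unbounded_height x) ->
  (forall N, exists k y, N <= k /\ A (iter k f y)) ->
  exists L, is_ladder f L.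
Proof.
move=> nper anti bnd unb.
have [|u [p [uP pmono]]] := @increasing_choice T (fun x n => A x /\ height x n).
  move=> N; have [k [y [Nk Ay]]] := unb N.
  have [n hn] := has_height (bnd _ Ay).
  exists (iter k f y), n; split=> //.
  by apply: leq_trans Nk _; case: hn => _; apply.
have /choice[t tP] : forall m, exists y, iter (p m) f y = u m.
  by move=> m; have [_ []] := uP m.
have uE m n : u m = u n -> m = n.
  move=> E; have pE : p m = p n.
    by apply: height_uniq (uP m).2 _; rewrite E; case: (uP n).
  by case: (ltngtP m n) => // /pmono; rewrite pE ltnn.
have tK m k : k <= p m -> iter k f (iter (p m - k) f (t m)) = u m.
  by move=> kp; rewrite -iterD subnKC.
(* The rung runs from the root [u m] at index 0 to the leaf [t m] at index [p m]. *)
pose l m k := iter (p m - k) f (t m).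
exists (\bigcup_m [set l m k | k in [set k | k <= p m]]), p, l.
split=> //.
- split=> // m n _ _ [x [[i /= ip <-] [j /= jp E]]]; apply: uE.
  have Am := (uP m).1; have An := (uP n).1.
  have im : iter i f (l m i) = u m by apply: tK.
  have jm : iter j f (l m i) = u n by rewrite -E; apply: tK.
  case/orP: (leq_total i j) => ij.
    by apply: (anti _ _ (j - i)) => //; rewrite -im -iterD subnK.
  by apply/esym/(anti _ _ (i - j)) => //; rewrite -jm -iterD subnK.
- move=> m _ [k /= kp <-] /(@iter_Per _ k); rewrite tK //.
  by apply: nper; case: (uP m).
- move=> m k /andP[k0 kp]; rewrite /l -iterS; congr (iter _ f _).
  by rewrite -subSn // -[in LHS](prednK k0) subSS.
(* A preimage of the leaf would give a backward path longer than the height. *)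
- move=> m; apply/seteqP; split=> // y /=; rewrite /l subnn /= => fy.
  have [_ [_ /(_ (p m).+1 y)]] := uP m.
  by rewrite iterSr fy tP => /(_ erefl); rewrite ltnn.
Qed.

(** Otherwise choice gives an infinite backward sequence inside [Q]; a repetition would make a term
    periodic, so it is a string. *)
Lemma no_string_minimal (Q : T -> Prop) : (forall s, ~ is_string f s) ->
  (forall x, Q x -> ~ Per f x) -> (exists x, Q x) ->
  exists x, Q x /\ forall y, f y = x -> ~ Q y.
Proof.
move=> nos Qnp [x0 Qx0]; apply: contrapT => nomin.
have /choice[g gP] : forall x, exists y, Q x -> f y = x /\ Q y.
  move=> x; apply: contrapT => /forallNP H; apply: nomin; exists x.
  split; first by apply: contrapT => nQ; apply: (H x).
  by move=> y fy Qy; apply: (H y).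
pose s n := iter n g x0.
have Qs n : Q (s n) by elim: n => //= n /gP[].
have fs n : f (s n.+1) = s n by have [] := gP _ (Qs n).
apply: (nos s); split=> // i j E.
wlog ij : i j E / i < j.
  by move=> W; case: (ltngtP i j) => // ij; [apply: W|apply/esym/W].
exfalso; apply: (Qnp _ (Qs j)); exists (j - i); first by rewrite subn_gt0.
by rewrite -[in RHS]E -[in s j](subnK (ltnW ij)) string_iter.
Qed.

(** A forward orbit that avoids [Per f] cannot repeat, hence is infinite. *)
Lemma no_orbit_Per x : (forall s, ~ is_infinite_orbit f s) ->
  exists n, Per f (iter n f x).
Proof.
move=> noo; apply: contrapT => /forallNP np.
apply: (noo (fun n => iter n f x)); split=> // i j E.
wlog ij : i j E / i < j.
  by move=> W; case: (ltngtP i j) => // ij; [apply: W|apply/esym/W].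
by case: (np i); apply: iter_eq_Per E.
Qed.

Lemma nonper_bounded_height x :
  (forall s, ~ is_string f s) -> (forall L, ~ is_ladder f L) ->
  ~ Per f x -> ~ unbounded_height x.
Proof.
move=> nos nol npx Ux.
have [||z [[npz Uz] zmin]] :=
  @no_string_minimal (fun z => ~ Per f z /\ unbounded_height z) nos.
- by move=> ? [].
- by exists x.
have npc y : f y = z -> ~ Per f y by move=> fy /(@iter_Per _ 1); rewrite /= fy.
(* If one preimage of [z] were a proper iterate of another, [z] would be periodic. Dropping the last
   step of a path into [z] costs one unit, hence [N.+1] below. *)
have [|||| L /nol//] := @antichain_ladder (f @^-1` [set z]).
- by move=> y /= /npc.
- move=> a b [//|n] fa fb E; case: npz; exists n.+1 => //.
  by rewrite -[in iter _ _ z]fa -iterSr iterS E.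
- by move=> y fy Uy; apply: (zmin y) => //; split=> //; apply: npc.
- move=> N; have [[|k] [y [Nk yk]]] := Uz N.+1; first by [].
  by exists k, y; split.
Qed.

Lemma iter_into_Per : (forall s, ~ is_string f s) ->
  (forall s, ~ is_infinite_orbit f s) -> (forall L, ~ is_ladder f L) ->
  exists N, forall x, Per f (iter N f x).
Proof.
move=> nos noo nol; apply: contrapT => /forallNP unb.
have [|||| L /nol//] := @antichain_ladder [set x | ~ Per f x /\ Per f (f x)].
- by move=> x [].
- move=> x y [//|n] [_ pfx] [npy _] E; case: npy.
  by rewrite -E iterSr; apply: iter_Per.
- by move=> x [npx _]; apply: nonper_bounded_height.
- move=> N; have /existsNP[y npy] := unb N.
  (* The first entry into [Per f] happens at time [k.+1 > N], so [iter k f y] lies in the antichain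
     and ends a backward path of length [k >= N]. *)
  have [[|k] [pk kmin]] := nat_ex_min _ (no_orbit_Per y noo).
    by case: npy; apply: iter_Per.
  exists k, y; split; last by split=> // /kmin; rewrite ltnn.
  rewrite leqNgt; apply/negP => kN; apply: npy.
  by rewrite -(subnK kN) iterD; apply: iter_Per.
Qed.

Lemma Per_bounded : (forall L, ~ is_periodic_ladder f L) ->
  exists N, Per f = Per_le f N.
Proof.
move=> nop; apply: contrapT => /forallNP unb.
have [|L /nop//] := unbounded_period_ladder.
move=> N; apply: contrapT => H; apply: (unb N); apply/seteqP.
split; last exact: Per_le_sub.
move=> x /Per_has_period[n pn]; exists n => //.
rewrite leqNgt; apply/negP => Nn; apply: H.
by exists x, n; split=> //; apply: ltnW.
Qed.

(** * Preimages of periodic points, and chains of quasi-periodic maps *)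

Lemma Per_iter_preimage x n : Per f x -> exists y, iter n f y = x.
Proof.
move=> [p p0 px]; exists (iter (n * p - n) f x).
by rewrite -iterD subnKC ?iter_mul_fixed // leq_pmulr.
Qed.

Lemma quasi_periodic_bounded : quasi_periodic f -> bounded_map f.
Proof.
move=> [n [m [nm nmE]]]; exists m => I tot.
have [->|/set0P[i0 Ii0]] := eqVneq I set0; first exact: card_ge0.
have [j Ij jtop] : exists2 j, I j & forall i, I i -> preorder_le f i j.
  have [allP|/existsNP[k0 nk0]] :=
      pselect (forall k i, I i -> exists y, iter k f y = i).
    (* Every [i] in [I] is an [n]-th iterate, hence fixed by [iter (m - n) f]; if [i0] is reached
       from [i], going on around the cycle leads back to [i]. *)
    exists i0 => // i Ii; have [//|[s si]] := tot i i0 Ii Ii0.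
    have [y yi] := allP n i Ii.
    have ix : iter (m - n) f i = i.
      by rewrite -[in LHS]yi -iterD subnK 1?ltnW // -nmE.
    exists (s * (m - n) - s); rewrite -si -iterD subnK ?iter_mul_fixed //.
    by rewrite leq_pmulr // subn_gt0.
  (* A point of I with the fewest iterated preimages is a top element. *)
  have [|k [nk kmin]] := @nat_ex_min
      (fun k => ~ forall i, I i -> exists y, iter k f y = i).
    by exists k0.
  have /existsNP[j /not_implyP[Ij jk]] := nk.
  exists j => // i Ii; have [//|[[|s] si]] := tot i j Ii Ij; first by exists 0.
  (* If [j] is [s.+1] steps after [i], minimality gives [i] a preimage under [iter k f], and then
     [j] has one under [iter k.+1 f], a contradiction. *)
  case: k nk kmin jk => [|k] nk kmin jk; first by case: jk; exists j.
  have [y yi] : exists y, iter k f y = i.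
    by apply: contrapT => niy; have := kmin k (fun H => niy (H i Ii)); rewrite ltnn.
  case: jk; exists (iter s f y); rewrite -si -yi -!iterD.
  by congr (iter _ f _); rewrite addSnnS addnC.
have sub : I `<=` (fun k => iter k f j) @` `I_m.
  move=> i /jtop[s0 s0i].
  have [|s [si smin]] := @nat_ex_min (fun k => iter k f j = i); first by exists s0.
  (* A first hitting time [s >= m] could be shortened by trading [m] steps for [n]. *)
  exists s => //=; rewrite ltnNge; apply/negP => ms.
  have /smin : iter (s - m + n) f j = i.
    by rewrite iterD nmE -iterD subnK.
  by rewrite leqNgt -[X in _ < X](subnK ms) ltn_add2l nm.
exact: card_le_trans (subset_card_le sub) (card_image_le _ _).
Qed.

End SelfMapTheory.

Theorem theorem3p3 (Gamma : Type) (lambda : Gamma -> Gamma) :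
  [<->
    (* (a) *) bounded_map lambda;
    (* (b) *) [/\ string_number lambda = cardinal0,
                  orbit_number lambda = cardinal0,
                  ladder_number lambda = cardinal0 &
                  periodic_ladder_number lambda = cardinal0];
    (* (c) *) exists N : nat,
                [/\ 0 < N,
                    iter N lambda @^-1` (~` Per lambda) = set0 &
                    Per lambda = Per_le lambda N];
    (* (d) *) exists N : nat,
                [/\ 0 < N,
                    iter N lambda @` setT = Per lambda &
                    Per lambda = Per_le lambda N];
    (* (e) *) quasi_periodic lambda ].
Proof.
tfae.
- move=> bd; split; apply/sup_cardinal_eq0.
  + exact: bounded_no_string.
  + exact: bounded_no_orbit.
  + exact: bounded_no_ladder.
  + exact: bounded_no_periodic_ladder.
- move=> [/sup_cardinal_eq0 nos /sup_cardinal_eq0 noo /sup_cardinal_eq0 nol].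
  move=> /sup_cardinal_eq0 nop.
  have [N1 HN1] := iter_into_Per nos noo nol.
  have [N2 HN2] := Per_bounded nop.
  (* Both properties persist for larger bounds; the successor ensures positivity. *)
  exists (N1 + N2).+1; split=> //.
  + apply/seteqP; split=> // x /=; apply.
    by rewrite -iterS -addnS addnC iterD; apply: iter_Per.
  + apply/seteqP; split; last exact: Per_le_sub.
    by rewrite HN2; apply: Per_leS; rewrite -addSn leq_addl.
- move=> [N [N0 HN PN]]; exists N; split=> //; apply/seteqP; split.
  + move=> _ [x _ <-]; apply: contrapT => np.
    by have /seteqP[/(_ x np)] := HN.
  + by move=> x /(Per_iter_preimage N)[y <-]; exists y.
(* After [N] steps every point is periodic with period at most [N], and every such period divides
   the factorial. *)
- move=> [N [N0 HN PN]]; exists N, (N`! + N); split.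
    by rewrite -[X in X < _]add0n ltn_add2r fact_gt0.
  apply/funext => x; rewrite iterD.
  have : Per lambda (iter N lambda x) by rewrite -HN; exists x.
  rewrite PN => -[p [p0 px _] pN].
  have /dvdnP[q ->] : p %| N`! by apply: dvdn_fact; rewrite p0.
  by rewrite iter_mul_fixed.
- exact: quasi_periodic_bounded.
Qed.
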